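(* Let $(T, \leq_T, \leq_{lex})$ be a Baumgartner tree. Then the linear order $(T, \leq_{lex})$ is strongly surjective.
   Context: All linear orders are assumed non-empty. A linear order $M$ is strongly surjective if for every linear order $L$ that embeds into $M$ (via an order preserving injection) there is an epimorphism (order preserving surjection) from $M$ onto $L$. A partial order $(T,\leq_T)$ is a tree if for every $t\in T$ the set $\{s \in T \mid s <_T t\}$ is well-ordered by $\leq_T$; its order type is the length of $t$. $T^\alpha$ is the set of nodes of length $\alpha$ (the $\alpha$th level), and the height of $T$ is the least $\alpha$ with $T^\alpha=\emptyset$. Two nodes $s,t$ belong to the same brotherhood if $\{r \mid r<_T s\} = \{r\mid r<_T t\}$. If every brotherhood of $T$ is equipped with a linear order, $T$ is called doubly ordered, and is linearly ordered by the lexicographic order $\leq_{lex}$: $s \leq_{lex} t$ iff either $s\leq_T t$, or $s,t$ are $\leq_T$-incomparable and, for the unique distinct $s' \leq_T s$ and $t' \leq_T t$ lying in the same brotherhood, $s'$ precedes $t'$ in the order of that brotherhood. Two doubly ordered trees are isomorphic if there is a bijection between them which preserves both the partial orders and the lexicographic linear orders (i.e. is an isomorphism for both). A subset $X\subseteq T$ is considered with the restrictions of $\leq_T$ and $\leq_{lex}$. A doubly ordered tree $(T,\leq_T,\leq_{lex})$ is a Baumgartner tree if: - $(T,\leq_T)$ is a Suslin tree: every chain and every antichain in $T$ is countable, the height of $T$ is $\omega_1$, and for all $t\in T^\alpha$ and all $\beta<\omega_1$ with $\alpha\leq\beta$ there is $s\in T^\beta$ with $t\leq_T s$. - $T$ has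 rational brotherhoods: the ordering of each brotherhood of $T$ is isomorphic to $\mathbb{Q}$. - For every $X\subseteq T$ of cardinality $\aleph_1$, if $X$ is cofinal with respect to $\leq_T$ in $\{t\in T \mid \exists s\in X\ (s\leq_T t)\}$ (every element of this set is $\leq_T$ some element of $X$), and $X$ has a rational basis (the set of $\leq_T$-minimal elements of $X$, ordered by $\leq_{lex}$, is isomorphic to $\mathbb{Q}$), then $(X,\leq_T,\leq_{lex})\cong(T,\leq_T,\leq_{lex})$. *)

(* Defs.v *)
From mathcomp Require Import all_boot all_order all_algebra.
From mathcomp Require Import boolp classical_sets functions cardinality wochoice.

Set Implicit Arguments.
Unset Strict Implicit.
Unset Printing Implicit Defensive.

Import Order.TTheory.

Local Open Scope classical_set_scope.
Local Open Scope order_scope.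

Definition linear_order (M : Type) (leM : rel M) : Prop :=
  inhabited M /\ total_order leM.

Definition strongly_surjective (M : Type) (leM : rel M) : Prop :=
  linear_order leM /\
  forall (L : Type) (leL : rel L), linear_order leL ->
    (exists e : L -> M, injective e /\ {homo e : x y / leL x y >-> leM x y}) ->
    exists p : M -> L,
      (forall y, exists x, p x = y) /\ {homo p : x y / leM x y >-> leL x y}.

Definition restr (M : Type) (R : rel M) (A : set M) : rel A := relpre val R.
Arguments restr {M} R A.

Definition order_iso (M N : Type) (leM : rel M) (leN : rel N) : Prop :=
  exists f : M -> N, bijective f /\ {mono f : x y / leM x y >-> leN x y}.

(* An ordinal is represented by any well-ordered type of that order type. If
   [leW] represents an ordinal, the smaller ordinals are represented by the
   orders [segment leW w]. *)
Definition below (W : Type) (leW : rel W) (w : W) : set W :=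
  [set v | leW v w /\ v <> w].

Definition segment (W : Type) (leW : rel W) (w : W) : rel (below leW w) :=
  restr leW (below leW w).
Arguments segment {W} leW w.

(* [leW] is the least uncountable ordinal. *)
Definition is_omega1 (W : Type) (leW : rel W) : Prop :=
  [/\ well_order leW, ~ countable [set: W] &
      forall w, countable (below leW w)].

Definition has_card_aleph1 (M : Type) (A : set M) : Prop :=
  exists (W : Type) (leW : rel W), is_omega1 leW /\ (A #= [set: W])%card.

Section Trees.
Context {d : Order.disp_t} {T : porderType d}.
Implicit Types (s t : T) (X : set T).

Definition preds t : set T := [set s | s < t].

Definition brotherhood t : set T := [set s | preds s = preds t].

Definition level (W : Type) (leW : rel W) : set T :=
  [set t | order_iso (restr <=%O (preds t)) leW].

Definition has_height (W : Type) (leW : rel W) : Prop :=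
  level leW = set0 /\ forall w, level (segment leW w) !=set0.

Definition min_elements X : set T :=
  [set x | X x /\ forall y, X y -> y <= x -> y = x].

Definition cofinal_in_upclosure X : Prop :=
  forall t, (exists s, X s /\ s <= t) -> exists x, X x /\ t <= x.

End Trees.

Definition is_tree d (T : porderType d) : Prop :=
  forall t : T, well_order (restr <=%O (preds t)).

Definition is_suslin_tree d (T : porderType d) : Prop :=
  [/\ is_tree T,
      forall C : set T, (forall x y, C x -> C y -> x >=< y) -> countable C,
      forall A : set T, (forall x y, A x -> A y -> x <> y -> x >< y) ->
        countable A &
      exists (W : Type) (leW : rel W),
        [/\ is_omega1 leW, has_height (T := T) leW &
            forall a b : W, leW a b ->
            forall t : T, level (segment leW a) t ->
            exists s : T, level (segment leW b) s /\ t <= s]].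

(* The orders of all the brotherhoods are given by a single relation [br], whose
   values between nodes of different brotherhoods are irrelevant. *)
Definition doubly_ordered d (T : porderType d) (br : rel T) : Prop :=
  is_tree T /\ forall t : T, total_order (restr br (brotherhood t)).

Definition lex d (T : porderType d) (br : rel T) : rel T := fun s t =>
  `[< s <= t \/
      (s >< t /\
       exists s' t' : T, [/\ s' <> t', s' <= s, t' <= t,
         brotherhood s' = brotherhood t' & br s' t']) >].

Definition rational_brotherhoods d (T : porderType d) (br : rel T) : Prop :=
  forall t : T, order_iso (restr br (brotherhood t)) (<=%O : rel rat).

Definition rational_basis d (T : porderType d) (br : rel T) (X : set T) : Prop :=
  order_iso (restr (lex br) (min_elements X)) (<=%O : rel rat).

Definition doubly_iso_to_tree d (T : porderType d) (br : rel T) (X : set T) :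
    Prop :=
  exists f : X -> T,
    [/\ bijective f,
        {mono f : x y / restr <=%O X x y >-> x <= y} &
        {mono f : x y / restr (lex br) X x y >-> lex br x y}].

Definition baumgartner_tree d (T : porderType d) (br : rel T) : Prop :=
  [/\ doubly_ordered br,
      is_suslin_tree T,
      rational_brotherhoods br &
      forall X : set T,
        has_card_aleph1 X -> cofinal_in_upclosure X -> rational_basis br X ->
        doubly_iso_to_tree br X].

(* Main.v *)
(* Identify [L] with a suborder [S] of [T].  Call [t] big if above every
   [s >= t] there are uncountably many elements of [S].  Since antichains and
   chains are countable, all but countably many elements of [S] are big, and
   the minimal big elements of [S] form a countable antichain.  Hence [S] is a
   sum, over a countable order [I], of singletons and of blocks
   [{a} + {x in S | x > a}] with [a] big, and the Baumgartner property makes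
   the second summand of each block a copy of [T].
   By Cantor's theorem the order of the roots of [T] is isomorphic to [I * rat],
   so the first coordinate of the root maps [T] monotonically onto [I].  Above a
   block [{a} + {x in S | x > a}], cut the fibre at some root: the nodes up to
   the cut go to [a], and the remaining ones form a copy of [T], hence can be
   mapped isomorphically onto [{x in S | x > a}]. *)

Require Import Defs.
From mathcomp Require Import all_boot all_order all_algebra.
From mathcomp Require Import boolp classical_sets cardinality wochoice.

Set Implicit Arguments.
Unset Strict Implicit.
Unset Printing Implicit Defensive.

Import Order.TTheory Num.Theory.

Local Open Scope classical_set_scope.
Local Open Scope order_scope.

(** * Countable dense linear orders *)

(** For a total [le], the negation [~~ le y x] says that [x] lies strictly before [y], so no
    separate strict relation has to be carried along. *)
Definition dense_unbounded (M : Type) (le : rel M) : Prop :=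
  [/\ forall x y, ~~ le y x -> exists z, ~~ le z x /\ ~~ le y z,
      forall x, exists y, ~~ le x y & forall x, exists y, ~~ le y x].

Definition rational_like (M : Type) (le : rel M) : Prop :=
  [/\ linear_order le, countable [set: M] & dense_unbounded le].

Lemma total_nle (M : Type) (le : rel M) : total_order le ->
  forall x y, ~~ le x y -> le y x.
Proof. by move=> [_ tot] x y; case/orP: (tot x y) => ->. Qed.

Lemma total_eq (M : Type) (le : rel M) : total_order le ->
  forall x y, le x y -> le y x -> x = y.
Proof. by move=> [[_ anti] _] x y xy yx; apply: anti; rewrite xy. Qed.

Lemma total_refl (M : Type) (le : rel M) : total_order le -> reflexive le.
Proof. by move=> [[[]]]. Qed.

Lemma total_trans (M : Type) (le : rel M) : total_order le -> transitive le.
Proof. by move=> [[[]]]. Qed.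

Lemma inj_surj_bijective (M N : Type) (f : M -> N) :
  injective f -> (forall y, exists x, f x = y) -> bijective f.
Proof.
move=> injf /choice[g gK]; exists g => // x; apply: injf; exact: gK.
Qed.

Lemma seq_max (N : eqType) (le : rel N) (A : seq N) : total_order le ->
  A = [::] \/ exists2 m, m \in A & {in A, forall a, le a m}.
Proof.
move=> tot; elim: A => [|a A [->|[m mA mP]]]; first by left.
  by right; exists a => [|b]; rewrite !inE // => /eqP->; exact: total_refl.
right; case: (boolP (le a m)) => am.
  exists m => [|b]; first by rewrite inE mA orbT.
  by rewrite inE => /orP[/eqP->|/mP].
exists a => [|b]; first by rewrite inE eqxx.
rewrite inE => /orP[/eqP->|/mP bm]; first exact: total_refl.
exact: total_trans bm (total_nle tot am).
Qed.

Lemma total_order_flip (M : Type) (le : rel M) :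
  total_order le -> total_order (fun x y => le y x).
Proof.
move=> [[[r t] a] tot]; split; last by move=> x y; exact: tot.
split; last by move=> x y /andP[xy yx]; apply: a; rewrite xy yx.
by split=> // y x z xy yz; exact: t yz xy.
Qed.

Lemma lt_le_not (M : Type) (le : rel M) : total_order le ->
  forall x y z, ~~ le y x -> le y z -> ~~ le z x.
Proof.
by move=> tot x y z yx yz; apply: contra yx; exact: (total_trans tot).
Qed.

Lemma le_lt_not (M : Type) (le : rel M) : total_order le ->
  forall x y z, le x y -> ~~ le z y -> ~~ le z x.
Proof.
move=> tot x y z xy; apply: contra => zx; exact: (total_trans tot) zx xy.
Qed.

(** Density yields a point between the largest entry of [A] and the least entry of [B]. If one list
    is empty, the absence of endpoints replaces density; if both are, any point will do. *)
Lemma seq_gap (N : eqType) (le : rel N) (A B : seq N) : rational_like le ->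
  {in A & B, forall a b, ~~ le b a} ->
  exists y, {in A, forall a, ~~ le y a} /\ {in B, forall b, ~~ le b y}.
Proof.
move=> [[[x0] tot] _ [dens lo up]] AB.
have [->|[a aA amax]] := seq_max A tot.
  have [->|[b bB bmin]] := seq_max B (total_order_flip tot); first by exists x0.
  have [y by_] := lo b; exists y; split=> // b' /bmin.
  exact: lt_le_not.
have [->|[b bB bmin]] := seq_max B (total_order_flip tot).
  have [y ay] := up a; exists y; split=> // a' /amax a'a.
  exact: le_lt_not ay.
have [y [ay yb]] := dens _ _ (AB _ _ aA bB).
exists y; split=> [a' /amax a'a|b' /bmin]; first exact: le_lt_not ay.
exact: lt_le_not.
Qed.

(** * Back-and-forth and Cantor's theorem *)

Section BackAndForth.
Context (M N : eqType) (leM : rel M) (leN : rel N).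

Definition partial_iso (s : seq (M * N)) : Prop :=
  {in s &, forall p q, leM p.1 q.1 = leN p.2 q.2}.

(** A point already in the domain keeps its image. Otherwise [seq_gap] places the new image between
    the images of the points before [x] and those of the points after [x]. *)
Lemma partial_iso_extend (s : seq (M * N)) (x : M) :
  total_order leM -> rational_like leN -> partial_iso s ->
  exists y, partial_iso ((x, y) :: s).
Proof.
move=> totM ratN isos; have totN : total_order leN by case: ratN => [[]].
suff [y yP] : exists y, {in s, forall p,
    leM p.1 x = leN p.2 y /\ leM x p.1 = leN y p.2}.
  exists y => p q; rewrite !inE.
  move=> /orP[/eqP->|ps] /orP[/eqP->|qs] /=.
  - by rewrite !total_refl.
  - by case: (yP _ qs).
  - by case: (yP _ ps).
  - exact: isos.
have [[p ps <-]|xNs] := pselect (exists2 p, p \in s & p.1 = x).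
  by exists p.2 => q qs; rewrite !isos.
have [|y [yA yB]] := @seq_gap _ leN [seq p.2 | p <- s & leM p.1 x]
    [seq p.2 | p <- s & leM x p.1] ratN.
  move=> _ _ /mapP[p + ->] /mapP[q + ->]; rewrite !mem_filter.
  move=> /andP[px ps] /andP[xq qs]; rewrite -isos //; apply/negP => qp.
  apply: xNs; exists p => //; apply: (total_eq totM px).
  exact: (total_trans totM) xq qp.
exists y => p ps; case: (boolP (leM p.1 x)) => px.
  have py : ~~ leN y p.2 by apply: yA; apply: map_f; rewrite mem_filter px.
  rewrite (total_nle totN py) (negbTE py); split=> //.
  apply/negbTE/negP => xp; apply: xNs; exists p => //.
  exact: total_eq xp.
have xp := total_nle totM px.
have py : ~~ leN p.2 y by apply: yB; apply: map_f; rewrite mem_filter xp.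
by rewrite xp (total_nle totN py) (negbTE py).
Qed.

End BackAndForth.

Lemma partial_iso_swap (M N : eqType) (leM : rel M) (leN : rel N) s :
  partial_iso leM leN s -> partial_iso leN leM [seq (p.2, p.1) | p <- s].
Proof.
by move=> isos _ _ /mapP[p ps ->] /mapP[q qs ->] /=; rewrite isos.
Qed.

(** Both orders are coded injectively in [nat]; step [n] adds the point of code [n], if there is
    one, first of [M] and then of [N]. *)
Theorem cantor_isomorphism (M N : eqType) (leM : rel M) (leN : rel N) :
  rational_like leM -> rational_like leN -> order_iso leM leN.
Proof.
move=> ratM ratN.
have [[_ totM] /countable_injP[f finj] _] := ratM.
have [[_ totN] /countable_injP[g ginj] _] := ratN.
have forth n s : partial_iso leM leN s -> exists s',
    [/\ partial_iso leM leN s', {subset s <= s'} &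
        forall x, f x = n -> exists y, (x, y) \in s'].
  move=> isos; have [[x fx]|nf] := pselect (exists x, f x = n); last first.
    by exists s; split=> // x fx; case: nf; exists x.
  have [y isoy] := partial_iso_extend x totM ratN isos.
  exists ((x, y) :: s); split=> // [p ps|x' fx'].
    by rewrite inE ps orbT.
  exists y; rewrite (_ : x' = x) ?mem_head //.
  by apply: finj; rewrite ?inE ?fx.
have back n s : partial_iso leM leN s -> exists s',
    [/\ partial_iso leM leN s', {subset s <= s'} &
        forall y, g y = n -> exists x, (x, y) \in s'].
  move=> isos; have [[y gy]|ng] := pselect (exists y, g y = n); last first.
    by exists s; split=> // y gy; case: ng; exists y.
  have [x isox] := partial_iso_extend y totN ratM (partial_iso_swap isos).
  exists ((x, y) :: s); split=> [|p ps|y' gy'].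
  - move: (partial_iso_swap isox); rewrite /= -map_comp.
    by rewrite (eq_map (_ : _ =1 id)) ?map_id // => -[].
  - by rewrite inE ps orbT.
  exists x; rewrite (_ : y' = y) ?mem_head //.
  by apply: ginj; rewrite ?inE ?gy.
(* [choice] requires a value everywhere: a list that is not a partial isomorphism is returned
   unchanged. *)
have /choice[F FP] : forall ns : nat * seq (M * N), exists s',
    partial_iso leM leN ns.2 -> [/\ partial_iso leM leN s',
      {subset ns.2 <= s'}, forall x, f x = ns.1 -> exists y, (x, y) \in s' &
      forall y, g y = ns.1 -> exists x, (x, y) \in s'].
  move=> [n s] /=; case: (pselect (partial_iso leM leN s)) => [isos|]; last first.
    by exists s.
  have [s1 [iso1 sub1 f1]] := forth n s isos.
  have [s2 [iso2 sub2 g2]] := back n s1 iso1.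
  exists s2 => _; split=> // [p /sub1 /sub2 //|x /f1[y /sub2]]; by exists y.
pose S := fix S n := if n is m.+1 then F (m, S m) else [::].
have isoS n : partial_iso leM leN (S n).
  by elim: n => [|n /(FP (n, S n))[]].
have subS m n : (m <= n)%N -> {subset S m <= S n}.
  elim: n => [|n IH]; first by rewrite leqn0 => /eqP->.
  rewrite leq_eqVlt => /orP[/eqP->//|/IH sub p /sub].
  by have [_ + _ _] := FP (n, S n) (isoS n); apply.
(* The point of code [n] is treated in passing from [S n] to [S n.+1], hence the successor in the
   witness. *)
have /choice[h hP] : forall x, exists y, exists n, (x, y) \in S n.
  move=> x; have [_ _ /(_ x erefl)[y ?] _] := FP (f x, S (f x)) (isoS _).
  by exists y; exists (f x).+1.
have Smono x y m x' y' n : (x, y) \in S m -> (x', y') \in S n ->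
    leM x x' = leN y y'.
  move=> xy xy'; apply: (isoS (maxn m n) (x, y) (x', y')).
    exact: (subS _ _ (leq_maxl m n)) xy.
  exact: (subS _ _ (leq_maxr m n)) xy'.
have hmono : {mono h : x y / leM x y >-> leN x y}.
  move=> x y; have [m xm] := hP x; have [n yn] := hP y.
  by rewrite (Smono _ _ _ _ _ _ xm yn).
exists h; split=> //; apply: inj_surj_bijective => [x y hxy|y].
  by apply: (total_eq totM); rewrite -hmono hxy total_refl.
have [_ _ _ /(_ y erefl)[x xy]] := FP (g y, S (g y)) (isoS _).
have [m xm] := hP x; exists x; apply: (total_eq totN).
  by rewrite -(Smono _ _ _ _ _ _ xm (xy : _ \in S (g y).+1)) total_refl.
by rewrite -(Smono _ _ _ _ _ _ (xy : _ \in S (g y).+1) xm) total_refl.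
Qed.

Lemma rational_like_rat : rational_like (<=%O : rel rat).
Proof.
split=> //.
  split; first exact: (inhabits 0%R).
  split; last by move=> x y; exact: le_total.
  split; last by move=> x y; exact: le_anti.
  by split=> [x|y x z]; [exact: lexx | exact: le_trans].
split=> [x y|x|x].
- rewrite -ltNge => /midf_lt[xz zy].
  by exists ((x + y) / 2%:R)%R; rewrite -!ltNge xz zy.
- by exists (x - 1)%R; rewrite -ltNge ltrBlDr ltrDl.
- by exists (x + 1)%R; rewrite -ltNge ltrDl.
Qed.

(* Project [I * rat], which is isomorphic to [rat] when ordered lexicographically. *)
Lemma rat_surjection (I : eqType) (leI : rel I) :
  linear_order leI -> countable [set: I] ->
  exists p : rat -> I, [/\ {homo p : x y / x <= y >-> leI x y},
    forall i, exists q, p q = i & forall q, exists2 q', q < q' & p q' = p q].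
Proof.
move=> [[i0] totI] cI.
pose leJ (a b : I * rat) := leI a.1 b.1 && (leI b.1 a.1 ==> (a.2 <= b.2)).
have ltJ a b : ~~ leJ b a = leI a.1 b.1 && (leI b.1 a.1 ==> (a.2 < b.2)).
  rewrite /leJ negb_and negb_imply -ltNge.
  case: (boolP (leI b.1 a.1)) => /= [|/(total_nle totI)->]//.
have totJ : total_order leJ.
  split; last first.
    move=> a b; rewrite /leJ.
    case: (boolP (leI a.1 b.1)) => ab; case: (boolP (leI b.1 a.1)) => ba //=.
      exact: le_total.
    by rewrite (total_nle totI ab) in ba.
  split; last first.
    move=> [a q] [b r]; rewrite /leJ /= => /andP[/andP[ab +] /andP[ba +]].
    rewrite ab ba /= => qr rq; congr pair; first exact: (total_eq totI).
    by apply/eqP; rewrite eq_le qr.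
  split=> [a|b a c]; first by rewrite /leJ total_refl /=.
  rewrite /leJ => /andP[ab /implyP ba2] /andP[bc /implyP cb2].
  rewrite (total_trans totI ab bc) /=; apply/implyP => ca.
  apply: (le_trans (ba2 _) (cb2 _)); first exact: (total_trans totI) bc ca.
  exact: (total_trans totI) ca ab.
have ratJ : rational_like leJ.
  split; first by split=> //; exact: (inhabits (i0, 0%R)).
    by rewrite -setXTT; exact: countableX.
  have r0 := total_refl totI; have [_ _ [dens lo up]] := rational_like_rat.
  split=> [[a q] [b r]|[a q]|[a q]].
  - rewrite ltJ /= => /andP[ab /implyP qr].
    have [ba|ba] := boolP (leI b a).
      have [|z [qz zr]] := dens q r; first by rewrite -ltNge qr.
      by exists (a, z); rewrite !ltJ /= !r0 ab ba /= !ltNge qz zr.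
    have [z qz] := up q; exists (a, z); rewrite !ltJ /= r0 ab (negbTE ba) /=.
    by rewrite ltNge qz.
  - by have [z qz] := lo q; exists (a, z); rewrite ltJ /= r0 /= ltNge qz.
  - by have [z qz] := up q; exists (a, z); rewrite ltJ /= r0 /= ltNge qz.
have [f [[g fK gK] fmono]] := cantor_isomorphism rational_like_rat ratJ.
exists (fun q => (f q).1); split=> [x y xy|i|q].
- by move: xy; rewrite -fmono => /andP[].
- by exists (g (i, 0%R)); rewrite gK.
exists (g ((f q).1, (f q).2 + 1)%R); last by rewrite gK.
by rewrite ltNge -fmono gK ltJ /= total_refl //= ltrDl.
Qed.

(** * Trees *)

Lemma countable_setU (U : Type) (A B : set U) :
  countable A -> countable B -> countable (A `|` B).
Proof.
move=> cA cB; rewrite -bigcup2E; apply: bigcup_countable => // i _.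
by case: i => [|[]] //= ?.
Qed.

Section Tree.
Context {d : Order.disp_t} {T : porderType d}.
Implicit Types (s t u : T) (P X Y : set T).

Hypothesis treeT : is_tree T.

Lemma preds_minimum t P : (exists2 s, s < t & P s) ->
  exists m, [/\ m < t, P m & forall s, s < t -> P s -> m <= s].
Proof.
move=> [s st Ps].
have [|z [[/asboolP Pz zP] _]] :=
    treeT (A := fun u : preds t => `[< P (val u) >]).
  by exists (SigSub (mem_set (st : preds t s))); apply/asboolP.
have zt : val z < t := set_valP z.
exists (val z); split=> // u ut Pu.
exact: (zP (SigSub (mem_set (ut : preds t u))) (asboolT Pu)).
Qed.

Lemma tree_minimal P t : P t -> exists2 m, m <= t & min_elements P m.
Proof.
move=> Pt; have [lt|nlt] := pselect (exists2 s, s < t & P s).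
  have [m [mt Pm mP]] := preds_minimum lt; exists m; first exact: ltW.
  split=> // y Py ym; apply/le_anti; rewrite ym mP //; exact: le_lt_trans mt.
exists t => //; split=> // y Py; rewrite le_eqVlt => /orP[/eqP//|yt].
by case: nlt; exists y.
Qed.

(** In the main case both nodes are strictly below [t], and the pair has a minimum in the well-order
    of the predecessors of [t]. *)
Lemma tree_comparable s t u : s <= t -> u <= t -> s >=< u.
Proof.
rewrite !le_eqVlt => /orP[/eqP->|st] /orP[/eqP->|ut]; first exact: comparablexx.
- by rewrite comparable_sym; exact/le_comparable/ltW.
- exact/le_comparable/ltW.
have [|m [_ + mP]] := @preds_minimum t [set x | x = s \/ x = u].
  by exists s => //; left.
case=> mE; rewrite mE in mP; first by apply/le_comparable/mP => //; right.
by rewrite comparable_sym; apply/le_comparable/mP => //; left.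
Qed.

Lemma tree_wf : well_founded (fun s t => s < t).
Proof.
move=> t; apply: contrapT => /(@tree_minimal [set x | ~ Acc _ x])[m _ [mA mP]].
apply: mA; constructor=> s sm; apply: contrapT => sA.
by move: (sm); rewrite (mP s sA (ltW sm)) ltxx.
Qed.

Lemma min_elements_antichain P s t :
  min_elements P s -> min_elements P t -> s <> t -> s >< t.
Proof.
move=> [Ps sP] [Pt tP] st; apply/negP; case/orP => le; apply: st.
  exact: tP.
by apply/esym/sP.
Qed.

(** By well-founded recursion, the rank of [t] is chosen outside the countable set of ranks of its
    predecessors. The ranks need not increase: the point is that the fibres are antichains, hence
    countable in a Suslin tree. *)
Lemma exists_rank (W : Type) :
  ~ countable [set: W] -> (forall t, countable (preds t)) ->
  exists rank : T -> W, forall s t, s < t -> rank s <> rank t.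
Proof.
move=> ncW cT.
(* [c] picks a point outside each countable set; its values on uncountable sets are arbitrary. *)
have /choice[c cP] : forall A : set W, exists w, countable A -> ~ A w.
  move=> A; have [cA|ncA] := pselect (countable A); last first.
    case: (pselect (exists w : W, True)) => [[w _]|nw]; first by exists w.
    by case: ncW; rewrite (_ : setT = set0) // -subset0 => w; case: nw; exists w.
  apply: contrapT => nA; apply: ncW.
  rewrite (_ : setT = A) // predeqE => w; split=> // _.
  by apply: contrapT => Aw; apply: nA; exists w.
pose F t (rec : forall s, s < t -> W) :=
  c [set w | exists s (h : s < t), rec s h = w].
pose rank := Fix tree_wf (fun=> W) F.
have rankE t : rank t = c [set w | exists s (h : s < t), rank s = w].
  rewrite /rank Fix_eq // => x f g fg; rewrite /F; congr c.
  by apply/seteqP; split=> _ [y [h <-]]; exists y, h; rewrite fg.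
exists rank => s t st; rewrite [rank t]rankE => srt.
apply: (cP [set w | exists s (h : s < t), rank s = w]); last by exists s, st.
rewrite (_ : [set w | _] = rank @` preds t); last first.
  by apply/seteqP; split=> [_ [u [ut <-]]|_ [u ut <-]]; exists u.
by apply: (sub_countable _ (cT t)); exact: card_image_le.
Qed.

End Tree.

(** [well_order] provides a unique minimum of every nonempty predicate, from which the order axioms
    are recovered; transitivity comes from the minimum of [x], [y] and [z]. *)
Lemma well_order_total (W : Type) (leW : rel W) :
  well_order leW -> total_order leW.
Proof.
elim/Pchoice: W leW => W leW wo.
have wch : wo_chain leW predT by move=> A _; exact: wo.
have rW : reflexive leW by move=> x; exact: (wo_chain_reflexive wch).
have aW : antisymmetric leW.
  by move=> x y; exact: (wo_chain_antisymmetric wch).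
split; last by move=> x y; exact: (wo_chainW wch).
split=> //; split=> // y x z xy yz.
have [|m [[]]] := wo [pred a | [|| a == x, a == y | a == z]].
  by exists x; rewrite inE eqxx.
move=> + lb _; have mx := lb x; have my := lb y; have mz := lb z.
rewrite !inE !eqxx ?orbT in mx my mz *.
case/or3P => /eqP mE; rewrite mE in mx my mz.
- exact: mz.
- by rewrite (aW x y) // xy mx.
- by rewrite -(aW y z) ?my ?yz.
Qed.

(* [X] is well-ordered with countable initial segments by comparing first the
   ranks, and then the positions in enumerations of the fibres of the rank. *)
Lemma suslin_uncountable_aleph1 d (T : porderType d) (X : set T) :
  is_suslin_tree T -> ~ countable X -> has_card_aleph1 X.
Proof.
move=> [treeT chainT antiT [W [leW [[woW ncW cW] _ _]]]] ncX.
have totW := well_order_total woW.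
have cT (t : T) : countable (preds t).
  by apply: chainT => x y /ltW xt /ltW yt; exact: (tree_comparable treeT xt yt).
have [rank rankP] := exists_rank treeT ncW cT.
have cfib w : countable [set t | rank t = w].
  apply: antiT => x y /= xw yw xy; case: (comparableP x y) => // [lt|lt].
    by case: (rankP _ _ lt); rewrite xw yw.
  by case: (rankP _ _ lt); rewrite xw yw.
have /choice[n nP] : forall w, exists f : T -> nat,
    {in [set t | rank t = w] &, injective f}.
  by move=> w; exact/countable_injP.
pose idx t := n (rank t) t.
pose le0 s t := leW (rank s) (rank t) &&
  (leW (rank t) (rank s) ==> (idx s <= idx t)%N).
have le0_anti : antisymmetric le0.
  move=> s t /andP[/andP[st st'] /andP[ts ts']].
  have rst : rank s = rank t by exact: (total_eq totW).
  apply: (nP (rank t)); rewrite ?inE //; apply/eqP.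
  by move: st' ts'; rewrite st ts /idx rst eqn_leq /= => -> ->.
exists X, (restr le0 X); split; last by rewrite card_eq_sym card_setT.
split.
- apply: antisymmetric_well_order => [x y xy|A [x0 Ax0]].
    by apply/val_inj/le0_anti.
  have [|w [[+ wP] _]] :=
      woW (fun w => `[< exists2 x, x \in A & rank (val x) = w >]).
    by exists (rank (val x0)); apply/asboolP; exists x0.
  move=> /asboolP[x1 Ax1 x1w].
  have ex : exists k, `[< exists2 x, x \in A &
      rank (val x) = w /\ idx (val x) = k >].
    by exists (idx (val x1)); apply/asboolP; exists x1.
  case: (ex_minnP ex) => k /asboolP[x Ax [xw xk]] kP.
  exists x; split=> // y Ay; rewrite /restr /= /le0.
  rewrite xw wP /=; last by apply/asboolP; exists y.
  apply/implyP => yw; rewrite xk; apply: kP; apply/asboolP; exists y => //.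
  split=> //; apply: (total_eq totW) => //; apply: wP.
  by apply/asboolP; exists y.
- by rewrite (eq_countable (card_setT X)).
move=> x; pose upto := below leW (rank (val x)) `|` [set rank (val x)].
have : countable (\bigcup_(w in upto) [set t | rank t = w]).
  by apply: bigcup_countable => //; exact: countable_setU.
move=> /countable_injP[f finj]; apply/countable_injP; exists (f \o val).
have sub y : below (restr le0 X) x y ->
    val y \in \bigcup_(w in upto) [set t | rank t = w].
  move=> [/andP[yx _] _]; apply/mem_set; exists (rank (val y)) => //.
  by have [->|ne] := pselect (rank (val y) = rank (val x)); [right | left].
move=> y z /set_mem/sub yx /set_mem/sub zx fyz.
by apply/val_inj/finj.
Qed.

(** * The lexicographic order *)

Section Lex.
Context {d : Order.disp_t} {T : porderType d} (br : rel T).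
Implicit Types (s t u : T) (X Y : set T).

Lemma brotherhood_eq s t :
  (brotherhood s = brotherhood t) <-> (preds s = preds t).
Proof.
split=> [|st]; last by rewrite /brotherhood st.
by move/predeqP => /(_ s) [/(_ erefl)].
Qed.

Hypothesis dblT : doubly_ordered br.

Let treeT : is_tree T := dblT.1.

Lemma br_refl t : br t t.
Proof.
have [[[r _] _] _] := dblT.2 t.
exact: (r (SigSub (mem_set (erefl : brotherhood t t)))).
Qed.

Lemma br_trans s t u : preds s = preds t -> preds t = preds u ->
  br s t -> br t u -> br s u.
Proof.
move=> st tu; have [[[_ tr] _] _] := dblT.2 u.
have us : brotherhood u s by rewrite /brotherhood /= st.
have ut : brotherhood u t by [].
have uu : brotherhood u u by [].
exact: (tr (SigSub (mem_set ut)) (SigSub (mem_set us)) (SigSub (mem_set uu))).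
Qed.

Lemma br_anti s t : preds s = preds t -> br s t -> br t s -> s = t.
Proof.
move=> st brst brts; have [[_ anti] _] := dblT.2 t.
have tt : brotherhood t t by [].
suff : SigSub (mem_set (st : brotherhood t s)) = SigSub (mem_set tt).
  by move/(congr1 val).
by apply: anti; apply/andP.
Qed.

Lemma br_total s t : preds s = preds t -> br s t || br t s.
Proof.
move=> st; have [_ tot] := dblT.2 t.
have tt : brotherhood t t by [].
exact: (tot (SigSub (mem_set (st : brotherhood t s))) (SigSub (mem_set tt))).
Qed.

Lemma brothers_eq s t : preds s = preds t -> s >=< t -> s = t.
Proof.
move=> pst; rewrite /Order.comparable !le_eqVlt.
case/orP => /orP[/eqP//|lt].
  by have : preds t s by []; rewrite -pst /preds /= ltxx.
by have : preds s t by []; rewrite pst /preds /= ltxx.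
Qed.

(* [s'] and [t'] are the distinct brothers at which the branches of [s] and [t]
   separate. *)
Definition fork s t s' t' : Prop :=
  [/\ s' <= s, t' <= t, preds s' = preds t' & s' <> t'].

Lemma fork_sym s t s' t' : fork s t s' t' -> fork t s t' s'.
Proof. by move=> [ss tt p ne]; split=> // e; apply: ne. Qed.

Lemma fork_incomparable s t s' t' : fork s t s' t' -> s >< t.
Proof.
move=> [ss tt p ne]; apply/negP => /orP[st|ts]; apply: ne;
  apply: brothers_eq p _.
  exact: (tree_comparable treeT (le_trans ss st) tt).
exact: (tree_comparable treeT ss (le_trans tt ts)).
Qed.

(** Take the first node below [s] that is not below [t], and symmetrically. All earlier nodes on
    either branch are common to both, so the two nodes are brothers. *)
Lemma fork_exists s t : s >< t -> exists s' t', fork s t s' t'.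
Proof.
move=> st.
have [|s1 s1s [[s1s' s1t] s1P]] :=
    tree_minimal treeT (t := s) (P := [set r | r <= s /\ ~ r <= t]).
  by split=> // le; rewrite /Order.comparable le in st.
have [|t1 t1t [[t1t' t1s] t1P]] :=
    tree_minimal treeT (t := t) (P := [set r | r <= t /\ ~ r <= s]).
  by split=> // le; rewrite /Order.comparable le orbT in st.
exists s1, t1; split=> //; last by move=> e; apply: s1t; rewrite e.
apply/seteqP; split=> r; rewrite /preds /= => lt.
  have rs := le_trans (ltW lt) s1s; have rt : r <= t.
    apply: contrapT => nrt; have re := s1P r (conj rs nrt) (ltW lt).
    by rewrite re ltxx in lt.
  case: (comparable_ltP (tree_comparable treeT rt t1t)) => // t1r.
  by case: t1s; exact: le_trans rs.
have rt := le_trans (ltW lt) t1t; have rs : r <= s.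
  apply: contrapT => nrs; have re := t1P r (conj rt nrs) (ltW lt).
  by rewrite re ltxx in lt.
case: (comparable_ltP (tree_comparable treeT rs s1s)) => // s1r.
by case: s1t; exact: le_trans rt.
Qed.

(** If [s1] were strictly below [s2], it would also precede the brother [t2] and so lie below [t],
    where it would be comparable with its distinct brother [t1]. *)
Lemma fork_le s t s1 t1 s2 t2 : fork s t s1 t1 -> fork s t s2 t2 -> s2 <= s1.
Proof.
move=> [ss1 tt1 p1 ne1] [ss2 tt2 p2 ne2].
case: (comparable_leP (tree_comparable treeT ss2 ss1)) => // lt.
have lt2 : preds t2 s1 by rewrite -p2.
case: ne1; apply: brothers_eq p1 _.
exact: (tree_comparable treeT (le_trans (ltW lt2) tt2) tt1).
Qed.

Lemma fork_unique s t s1 t1 s2 t2 : fork s t s1 t1 -> fork s t s2 t2 ->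
  s1 = s2 /\ t1 = t2.
Proof.
move=> f1 f2; split; apply/le_anti.
  by rewrite (fork_le f1 f2) (fork_le f2 f1).
by rewrite (fork_le (fork_sym f1) (fork_sym f2))
  (fork_le (fork_sym f2) (fork_sym f1)).
Qed.

Lemma le_lex s t : s <= t -> lex br s t.
Proof. by move=> st; apply/asboolP; left. Qed.

(** Since forks are unique, any fork at hand decides the lexicographic comparison; the later
    arguments compute with this rule instead of the definition of [lex]. *)
Lemma lex_fork s t s' t' : fork s t s' t' -> lex br s t = br s' t'.
Proof.
move=> f; have st := fork_incomparable f; apply/asboolP/idP; last first.
  by case: (f) => ss tt p ne b; right; split=> //; exists s', t'; split=> //;
    apply/brotherhood_eq.
move=> [le|[_ [s2 [t2 [ne ss tt /brotherhood_eq p b]]]]].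
  by rewrite /Order.comparable le in st.
by have [-> ->] := fork_unique f (And4 ss tt p ne).
Qed.

Variant lex_spec s t : Prop :=
  | LexLe of s <= t
  | LexGe of t <= s
  | LexFork s' t' of fork s t s' t'.

Lemma lex_cases s t : lex_spec s t.
Proof.
case: (boolP (s >=< t)) => [/orP[]|/fork_exists[s' [t']]].
- exact: LexLe.
- exact: LexGe.
- exact: LexFork.
Qed.

Lemma lex_anti s t : lex br s t -> lex br t s -> s = t.
Proof.
have ge_anti u v : u <= v -> lex br v u -> u = v.
  move=> uv /asboolP[vu|[nuv _]]; first by apply/le_anti; rewrite uv.
  by rewrite /Order.comparable uv orbT in nuv.
case: (lex_cases s t) => [st _|ts st _|s' t' f].
- exact: ge_anti.
- by apply/esym/ge_anti.
rewrite (lex_fork f) (lex_fork (fork_sym f)) => b1 b2.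
by case: (f) => _ _ p; case; exact: br_anti.
Qed.

Lemma lex_total s t : lex br s t || lex br t s.
Proof.
case: (lex_cases s t) => [/le_lex->//|/le_lex->|s' t' f]; first by rewrite orbT.
rewrite (lex_fork f) (lex_fork (fork_sym f)); apply: br_total.
by case: f.
Qed.

Lemma lex_cases_br s t : lex br s t -> s <= t \/
  exists s' t', fork s t s' t' /\ br s' t'.
Proof.
move=> /asboolP[|[_ [s' [t' [ne ss tt /brotherhood_eq p b]]]]]; [by left|right].
by exists s', t'.
Qed.

(** Along the branch of [t], the lower of the two forks separates [s] from [u]. If both forks occur
    at the same node, transitivity inside the brotherhood decides. *)
Lemma lex_trans s t u : lex br s t -> lex br t u -> lex br s u.
Proof.
move=> /lex_cases_br[st|[s1 [t1 [f1 b1]]]] /lex_cases_br[tu|[t2 [u2 [f2 b2]]]].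
- exact/le_lex/le_trans/tu.
- have [t2t uu p ne] := f2.
  case: (comparable_leP (tree_comparable treeT t2t st)) => [t2s|lt].
    by rewrite (lex_fork (And4 t2s uu p ne)).
  have lt' : preds u2 s by rewrite -p.
  exact/le_lex/(le_trans (ltW lt')).
- have [ss tt p ne] := f1.
  by rewrite (lex_fork (And4 ss (le_trans tt tu) p ne)).
have [ss tt1 p1 ne1] := f1; have [tt2 uu p2 ne2] := f2.
case: (comparable_ltgtP (tree_comparable treeT tt1 tt2)) => [lt|lt|e].
- have lt' : preds u2 t1 by rewrite -p2.
  by rewrite (lex_fork (And4 ss (le_trans (ltW lt') uu) p1 ne1)).
- have lt' : preds s1 t2 by rewrite p1.
  by rewrite (lex_fork (And4 (le_trans (ltW lt') ss) uu p2 ne2)).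
subst t2; have p := etrans p1 p2.
rewrite (lex_fork (And4 ss uu p _)); first exact: br_trans b2.
by move=> e; apply: ne1; apply: br_anti => //; rewrite e.
Qed.

Lemma lex_total_order : total_order (lex br).
Proof.
split; last exact: lex_total.
split; last by move=> s t /andP[]; exact: lex_anti.
by split=> [t|t s u]; [exact: le_lex | exact: lex_trans].
Qed.

(** A fork of [s] and [t] is still a fork of any nodes above them, so cones of incomparable nodes
    are compared as whole blocks. *)
Lemma lex_block s t s' t' : s >< t -> s <= s' -> t <= t' ->
  lex br s' t' = lex br s t.
Proof.
move=> /fork_exists[s1 [t1 f]] ss tt; rewrite (lex_fork f).
have [ss1 tt1 p ne] := f.
exact/lex_fork/(And4 (le_trans ss1 ss) (le_trans tt1 tt) p ne).
Qed.

Lemma lex_brothers s t : preds s = preds t -> lex br s t = br s t.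
Proof.
move=> p; have [->|ne] := pselect (s = t); last exact: (lex_fork (And4 _ _ p ne)).
by rewrite br_refl le_lex.
Qed.

Lemma brothers_incomparable s t : preds s = preds t -> s <> t -> s >< t.
Proof. by move=> p ne; apply/negP => /(brothers_eq p). Qed.

(** * Brotherhoods and bases of rational order type *)

Section RationalBrotherhoods.
Hypothesis ratT : rational_brotherhoods br.

Lemma brotherhood_dense_unbounded t :
  dense_unbounded (restr (lex br) (brotherhood t)).
Proof.
have [f [[g fK gK] fmono]] := ratT t.
have E x y : restr (lex br) (brotherhood t) x y = (f x <= f y).
  have px : preds (val x) = preds t := set_valP x.
  have py : preds (val y) = preds t := set_valP y.
  by rewrite fmono /restr /= lex_brothers ?px.
have [_ _ [dens lo up]] := rational_like_rat.
split=> [x y|x|x]; rewrite ?E.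
- by move=> /dens[z [xz zy]]; exists (g z); rewrite !E gK.
- by have [y xy] := lo (f x); exists (g y); rewrite E gK.
- by have [y xy] := up (f x); exists (g y); rewrite E gK.
Qed.

Lemma brother_between s t : preds s = preds t -> ~~ lex br t s ->
  exists u, [/\ preds u = preds s, ~~ lex br u s & ~~ lex br t u].
Proof.
move=> p st; have [dens _ _] := brotherhood_dense_unbounded t.
have tt : brotherhood t t by [].
have [|z [sz zt]] :=
  dens (SigSub (mem_set (p : brotherhood t s))) (SigSub (mem_set tt)).
  exact: st.
by exists (val z); split=> //; rewrite p; exact: (set_valP z).
Qed.

Lemma brother_before t : exists u, preds u = preds t /\ ~~ lex br t u.
Proof.
have [_ lo _] := brotherhood_dense_unbounded t.
have tt : brotherhood t t by [].
have [z zt] := lo (SigSub (mem_set tt)).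
by exists (val z); split=> //; exact: (set_valP z).
Qed.

Lemma brother_after t : exists u, preds u = preds t /\ ~~ lex br u t.
Proof.
have [_ _ up] := brotherhood_dense_unbounded t.
have tt : brotherhood t t by [].
have [z zt] := up (SigSub (mem_set tt)).
by exists (val z); split=> //; exact: (set_valP z).
Qed.

Hypothesis antiT : forall A : set T,
  (forall x y, A x -> A y -> x <> y -> x >< y) -> countable A.

Lemma countable_min_elements X : countable (min_elements X).
Proof. by apply: antiT => x y; exact: min_elements_antichain. Qed.

(** The minimal elements form an antichain, hence are countable; Cantor's theorem reduces the claim
    to density and the absence of endpoints. *)
Lemma rational_basis_intro X : X !=set0 ->
  (forall s t, min_elements X s -> min_elements X t -> ~~ lex br t s ->
    exists u, [/\ min_elements X u, ~~ lex br u s & ~~ lex br t u]) ->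
  (forall t, min_elements X t -> exists2 u, min_elements X u & ~~ lex br t u) ->
  (forall t, min_elements X t -> exists2 u, min_elements X u & ~~ lex br u t) ->
  rational_basis br X.
Proof.
move=> [x Xx] dens lo up.
apply: cantor_isomorphism rational_like_rat; split.
- split.
    have [m _ mX] := tree_minimal treeT Xx.
    exact: (inhabits (SigSub (mem_set mX))).
  have [[[r t] a] tot] := lex_total_order.
  split; last by move=> u v; exact: tot.
  split; last by move=> u v /a/val_inj.
  by split=> [u|u v w]; [exact: r | exact: t].
- by rewrite (eq_countable (card_setT _)) countable_min_elements.
split=> [s t st|t|t].
- have [u [uX su ut]] := dens _ _ (set_valP s) (set_valP t) st.
  by exists (SigSub (mem_set uX)).
- by have [u uX tu] := lo _ (set_valP t); exists (SigSub (mem_set uX)).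
- by have [u uX tu] := up _ (set_valP t); exists (SigSub (mem_set uX)).
Qed.

(** The brother [e] is also above [a], so some minimal element [m] of [X] is comparable with [e]. If
    [m] were strictly below [e], it would be strictly below [t], against the choice of [t]. *)
Lemma brother_min_element X a t e : (forall x, X x -> a < x) ->
  (forall s, a < s -> exists2 x, X x & s <= x) ->
  a < t -> (forall m, X m -> ~ m < t) -> preds e = preds t ->
  exists2 m, min_elements X m & e <= m.
Proof.
move=> Xa Xcof at_ tmin p; have ae : a < e.
  by have : preds t a by []; rewrite -p.
have [x Xx ex] := Xcof e ae; have [m mx mX] := tree_minimal treeT Xx.
exists m => //; case: (comparable_leP (tree_comparable treeT ex mx)) => // me.
have : preds e m by []; rewrite p; case/tmin; by case: mX.
Qed.

(* Any two distinct minimal elements of [X] separate strictly above [a], and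
   the cone of any brother strictly between the separating brothers contains
   a minimal element of [X]. *)
Lemma cone_rational_basis X a : X !=set0 -> (forall x, X x -> a < x) ->
  (forall s, a < s -> exists2 x, X x & s <= x) -> rational_basis br X.
Proof.
move=> X0 Xa Xcof; have minN t m : min_elements X t -> X m -> ~ m < t.
  by move=> [_ tP] Xm /[dup] mt /ltW/(tP _ Xm) e; rewrite e ltxx in mt.
apply: rational_basis_intro => // [s t sX tX ts|t tX|t tX].
- have nst : s <> t by move=> e; rewrite e le_lex in ts.
  have st := min_elements_antichain sX tX nst.
  have [s' [t' f]] := fork_exists st; have [ss tt p ne] := f.
  have ts' : ~~ lex br t' s'.
    by rewrite (lex_brothers (esym p)) -(lex_fork (fork_sym f)).
  have [e [pe se et]] := brother_between p ts'.
  have as_ : a < s'.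
    have [Xs _] := sX; case: (comparable_ltP (tree_comparable treeT
      (ltW (Xa _ Xs)) ss)) => // sa.
    case: ne; apply: brothers_eq p _; apply: (tree_comparable treeT _ tt).
    by apply: (le_trans sa); apply: ltW; apply: Xa; case: tX.
  have [m mX em] : exists2 m, min_elements X m & e <= m.
    apply: (@brother_min_element X a s') => // m Xm ms.
    exact: (minN s m sX Xm (lt_le_trans ms ss)).
  have nes : e <> s' by move=> E; rewrite E le_lex in se.
  have net : e <> t' by move=> E; rewrite E le_lex in et.
  exists m; split=> //.
    rewrite (lex_block (brothers_incomparable _ nes)) //.
  rewrite (lex_block (s := t') (t := e)) //.
  by apply: brothers_incomparable; [rewrite pe p | move=> E; apply: net].
- have [e [pe et]] := brother_before t.
  have [m mX em] : exists2 m, min_elements X m & e <= m.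
    by apply: (@brother_min_element X a t) => // [|m Xm];
      [case: tX => /Xa | exact: minN].
  exists m => //; rewrite (lex_block (s := t) (t := e)) //.
  by apply: brothers_incomparable => // E; rewrite E le_lex in et.
- have [e [pe et]] := brother_after t.
  have [m mX em] : exists2 m, min_elements X m & e <= m.
    by apply: (@brother_min_element X a t) => // [|m Xm];
      [case: tX => /Xa | exact: minN].
  exists m => //; rewrite (lex_block (s := e) (t := t)) //.
  by apply: brothers_incomparable => // E; rewrite E le_lex in et.
Qed.

End RationalBrotherhoods.

End Lex.

(** * Baumgartner trees *)

Section Baumgartner.
Context {d : Order.disp_t} {T : porderType d} (br : rel T).
Implicit Types (s t u : T) (X Y S : set T).

Hypothesis baumT : baumgartner_tree br.

Let dblT : doubly_ordered br. Proof. by case: baumT. Qed.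
Let treeT : is_tree T := dblT.1.
Let suslinT : is_suslin_tree T. Proof. by case: baumT. Qed.
Let ratT : rational_brotherhoods br. Proof. by case: baumT. Qed.

Let antiT (A : set T) :
  (forall x y, A x -> A y -> x <> y -> x >< y) -> countable A.
Proof. by case: suslinT => _ _ + _; apply. Qed.

Let countable_preds t : countable (preds t).
Proof.
have [_ chainT _ _] := suslinT.
by apply: chainT => x y /ltW xt /ltW yt; exact: (tree_comparable treeT xt yt).
Qed.

(** This form of the Baumgartner property replaces cardinality aleph one by uncountability, and the
    isomorphism from a subtype by a self-map of [T] with image [X]. *)
Lemma baumgartner_copy X : ~ countable X -> cofinal_in_upclosure X ->
  rational_basis br X -> exists g : T -> T, [/\ forall t, X (g t),
    forall x, X x -> exists t, g t = x, {mono g : s t / s <= t} &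
    {mono g : s t / lex br s t}].
Proof.
move=> ncX cofX ratX; have [_ _ _ baum] := baumT.
have [f [[g fK gK] fle flex]] :=
  baum X (suslin_uncountable_aleph1 suslinT ncX) cofX ratX.
exists (val \o g); split=> [t|x Xx|s t|s t].
- exact: (set_valP (g t)).
- by exists (f (SigSub (mem_set Xx))); rewrite /= fK.
- by rewrite -{2}[s]gK -{2}[t]gK fle.
- by rewrite -{2}[s]gK -{2}[t]gK flex.
Qed.

(** Two copies of [T] are identified through [T]: invert [g] on [X], with arbitrary values
    elsewhere, then apply [h]. *)
Lemma baumgartner_copy_iso X Y (g h : T -> T) :
  (forall x, X x -> exists t, g t = x) -> (forall t, X (g t)) ->
  {mono g : s t / lex br s t} ->
  (forall y, Y y -> exists t, h t = y) -> (forall t, Y (h t)) ->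
  {mono h : s t / lex br s t} ->
  exists f : T -> T, [/\ forall x, X x -> Y (f x),
    forall y, Y y -> exists2 x, X x & f x = y &
    forall s t, X s -> X t -> lex br (f s) (f t) = lex br s t].
Proof.
move=> gsurj gX glex hsurj hY hlex.
have /choice[k kP] : forall x, exists t, X x -> g t = x.
  move=> x; have [/gsurj[t gt]|nX] := pselect (X x); first by exists t.
  by exists x.
exists (h \o k); split=> [x _|y /hsurj[t <-]|s t Xs Xt]; first exact: hY.
  exists (g t) => //=; congr h; apply: (lex_anti dblT); rewrite -glex.
    by rewrite kP // le_lex.
  by rewrite kP // le_lex.
by rewrite /= hlex -glex !kP.
Qed.

(** * Cones and roots *)

Definition upcone t : set T := [set s | t <= s].

Definition is_root (r : T) : Prop := preds r = set0.

Lemma root_exists t : exists r, is_root r /\ r <= t.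
Proof.
have [m mt [_ mP]] := tree_minimal treeT (P := setT) (t := t) I.
exists m; split=> //; rewrite /is_root -subset0 => s; rewrite /preds /= => sm.
by move: (sm); rewrite (mP s I (ltW sm)) ltxx.
Qed.

Lemma tree_inhabited : exists t : T, True.
Proof.
have [_ _ _ [W [leW [[_ ncW _] [_ lev] _]]]] := suslinT.
have [w _] : exists w : W, True.
  apply: contrapT => nw; apply: ncW.
  by rewrite (_ : setT = set0) // -subset0 => w; case: nw; exists w.
by have [t _] := lev w; exists t.
Qed.

Lemma root_min r s : is_root r -> s <= r -> s = r.
Proof.
move=> rr; rewrite le_eqVlt => /orP[/eqP//|sr].
by have : preds r s by []; rewrite rr.
Qed.

Lemma root_unique r s t : is_root r -> is_root s -> r <= t -> s <= t -> r = s.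
Proof.
move=> rr rs rt st; apply: (brothers_eq (etrans rr (esym rs))).
exact: (tree_comparable treeT rt st).
Qed.

Lemma root_function : exists root : T -> T,
  [/\ forall t, is_root (root t), forall t, root t <= t,
      forall r t, is_root r -> r <= t -> root t = r &
      forall s t, lex br s t -> lex br (root s) (root t)].
Proof.
have /choice[root rootP] := root_exists.
exists root; split=> [t|t|r t rr rt|s t st]; try by case: (rootP t).
  by have [? ?] := rootP t; exact: root_unique rt.
have [rs ss] := rootP s; have [rt tt] := rootP t.
have [->|ne] := pselect (root s = root t); first exact: le_lex.
rewrite -(lex_block dblT _ ss tt) //; apply: brothers_incomparable => //.
exact: etrans rs (esym rt).
Qed.

(** The roots form one brotherhood, hence a copy of [rat], to which [rat_surjection] applies. The
    last clause leaves room in each fibre to the right of any root used as a cut. *)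
Lemma root_surjection (root : T -> T) I :
  (forall t, is_root (root t)) ->
  (forall s t, lex br s t -> lex br (root s) (root t)) ->
  (forall r, is_root r -> root r = r) ->
  I !=set0 -> countable I ->
  exists p : T -> T, [/\ forall t, I (p t),
    forall s t, lex br s t -> lex br (p s) (p t),
    forall t, p (root t) = p t,
    forall i, I i -> exists2 r, is_root r & p r = i &
    forall r, is_root r ->
      exists r', [/\ is_root r', ~~ lex br r' r & p r' = p r]].
Proof.
move=> rootr rootlex rootE [i0 Ii0] cI.
have [t0 _] := tree_inhabited; have [r0 [r0r _]] := root_exists t0.
have rootB t : brotherhood r0 (root t).
  by rewrite /brotherhood /= r0r; exact: rootr.
have [f [[g fK gK] fmono]] := ratT r0.
pose b t : brotherhood r0 := SigSub (mem_set (rootB t)).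
have bE s t : (f (b s) <= f (b t)) = lex br (root s) (root t).
  rewrite fmono /restr /= lex_brothers //.
  exact: etrans (rootr _) (esym (rootr _)).
have gr q : is_root (val (g q)).
  by rewrite /is_root -r0r; exact: (set_valP (g q)).
have bg q : b (val (g q)) = g q by apply: val_inj => /=; exact/rootE/gr.
have totI : total_order (restr (lex br) I).
  have [[[r t] a] tot] := lex_total_order dblT.
  split; last by move=> u v; exact: tot.
  split; last by move=> u v /a/val_inj.
  by split=> [u|u v w]; [exact: r | exact: t].
have [||p [pmono psurj pup]] := @rat_surjection I (restr (lex br) I).
- by split=> //; exact: (inhabits (SigSub (mem_set Ii0))).
- by rewrite (eq_countable (card_setT _)).
exists (fun t => val (p (f (b t)))); split=> [t|s t st|t|i Ii|r rr].
- exact: (set_valP (p _)).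
- by apply: pmono; rewrite bE; exact: rootlex.
- congr (val (p (f _))); apply: val_inj => /=; exact/rootE/rootr.
- have [q pq] := psurj (SigSub (mem_set Ii)).
  by exists (val (g q)) => //; rewrite bg gK pq.
have [q' rq pq] := pup (f (b r)); exists (val (g q')); split; first exact: gr.
  rewrite -[val _](rootE _ (gr _)) -[X in lex _ _ X](rootE _ rr) -bE bg gK.
  by rewrite -ltNge.
by rewrite bg gK pq.
Qed.

(** * Blocks of a suborder and the epimorphism onto it *)

Section Suborder.
Variable S : set T.

Definition small : set T := [set t | countable (upcone t `&` S)].

Definition big : set T := [set t | forall s, t <= s -> ~ small s].

(** A point of [S] that is not big lies below a small node, hence is comparable with a minimal small
    node [m]: it is in the cone of [m] or among its predecessors. Both contribute countably many
    points, and such [m] form an antichain. *)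
Lemma countable_not_big : countable (S `\` big).
Proof.
pose M := min_elements small.
suff sub : S `\` big `<=` \bigcup_(m in M) ((upcone m `&` S) `|` preds m).
  apply: (sub_countable (subset_card_le sub)).
  apply: bigcup_countable => [|m [sm _]].
    exact: countable_min_elements.
  exact: countable_setU.
move=> t [St /existsNP[s /not_implyP[ts /contrapT ss]]].
have [m ms mM] := tree_minimal treeT ss; exists m => //.
case: (comparable_leP (tree_comparable treeT ms ts)) => mt; first by left.
by right.
Qed.

Lemma big_up s t : big s -> s <= t -> big t.
Proof. by move=> bs st u tu; apply: bs; exact: le_trans tu. Qed.

Lemma big_uncountable t : big t -> ~ countable (upcone t `&` (S `&` big)).
Proof.
move=> bt; have := bt t (lexx t); apply: contra_not; apply: sub_countable.
apply: subset_card_le => s [ts Ss]; split=> //; split=> //.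
exact: big_up ts.
Qed.

Definition above a : set T := [set x | [/\ S x, big x & a < x]].

Lemma above_uncountable a t : big a -> a <= t ->
  ~ countable (upcone t `&` above a).
Proof.
move=> ba at_ cnt; apply: (big_uncountable (big_up ba at_)).
have sub : upcone t `&` (S `&` big) `<=` (upcone t `&` above a) `|` [set a].
  move=> x [tx [Sx bx]]; have := le_trans at_ tx.
  by rewrite le_eqVlt => /orP[/eqP->|ax]; [right | left].
apply: (sub_countable (subset_card_le sub)); exact: countable_setU.
Qed.

Lemma above_cofinal a t : big a -> a < t -> exists2 x, above a x & t <= x.
Proof.
move=> ba at_; apply: contrapT => nx.
apply: (above_uncountable ba (ltW at_)).
rewrite (_ : (_ `&` _)%classic = set0) // -subset0 => x [tx ax]; apply: nx.
by exists x.
Qed.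

Lemma above_copy a : big a -> exists g : T -> T, [/\ forall t, above a (g t),
    forall x, above a x -> exists t, g t = x, {mono g : s t / s <= t} &
    {mono g : s t / lex br s t}].
Proof.
move=> ba; have nca : ~ countable (above a).
  move=> ca; apply: (above_uncountable ba (lexx a)).
  by apply: sub_countable ca; apply: subset_card_le => x [].
apply: baumgartner_copy => //.
  move=> t [x [[_ _ ax] xt]].
  by have [y ay ty] := above_cofinal ba (lt_le_trans ax xt); exists y.
apply: (@cone_rational_basis _ _ br dblT ratT antiT _ a).
- apply: contrapT => n0; apply: nca.
  by rewrite (_ : above a = set0) // -subset0 => x ax; apply: n0; exists x.
- by move=> x [].
- by move=> s; exact: above_cofinal.
Qed.

(** The copy [g] of [T] carries the cone of [t] onto the part of [above a] over [g t], which is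
    uncountable. This provides the uncountability of the part of a fibre beyond its cut. *)
Lemma upcone_uncountable a t : big a -> ~ countable (upcone t).
Proof.
move=> ba; have [g [gY gsurj gle _]] := above_copy ba.
have [_ _ ag] := gY t; move=> cnt; apply: (above_uncountable ba (ltW ag)).
suff sub : upcone (g t) `&` above a `<=` g @` upcone t.
  apply: (sub_countable (subset_card_le sub)).
  by apply: (sub_countable _ cnt); exact: card_image_le.
move=> x [gx /gsurj[s sx]]; exists s => //; rewrite /upcone /= -gle sx.
exact: gx.
Qed.

(** Each summand is represented by its lowest node, so the countable index order is just [lex]
    restricted to a subset of [S]. *)
Definition index_set : set T := (S `\` big) `|` min_elements (S `&` big).

Lemma countable_index_set : countable index_set.
Proof.
apply: countable_setU; first exact: countable_not_big.
exact: countable_min_elements.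
Qed.

Lemma index_set_neq0 : S !=set0 -> index_set !=set0.
Proof.
move=> [s Ss]; have [bs|nbs] := pselect (big s); last by exists s; left.
have [m _ mM] := tree_minimal treeT (P := S `&` big) (conj Ss bs).
by exists m; right.
Qed.

(** Bigness passes upwards, so no other index lies above the first point of a block. Thus blocks
    with distinct, tree-comparable indices can only have a singleton at the lower index. *)
Lemma index_min i j : min_elements (S `&` big) i -> index_set j -> i <= j ->
  i = j.
Proof.
move=> [[Si bi] _] [[_ nbj]|[[Sj bj] jP]] ij; last exact: jP.
by case: nbj; exact: big_up ij.
Qed.

Lemma suborder_epimorphism : S !=set0 -> exists p : T -> T,
  [/\ forall t, S (p t), forall s, S s -> exists t, p t = s &
      forall s t, lex br s t -> lex br (p s) (p t)].
Proof.
move=> S0; have totT := lex_total_order dblT.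
have [root [rootr root_le root_eq root_lex]] := root_function.
have rootE r : is_root r -> root r = r by move=> rr; exact: root_eq.
have [p [pI plex proot psurj pup]] :=
  root_surjection rootr root_lex rootE (index_set_neq0 S0)
    countable_index_set.
(* The root [c i] is the cut in the fibre over [i]. *)
have /choice[c cP] : forall i, exists r, index_set i -> is_root r /\ p r = i.
  move=> i; have [/psurj[r]|nI] := pselect (index_set i); first by exists r.
  by exists i.
(* Comparing the root of [t], not [t] itself, with the cut makes the right part a union of full
   cones of roots. *)
pose right_part i : set T := [set t | p t = i /\ ~~ lex br (root t) (c i)].
have right_copy i : min_elements (S `&` big) i -> exists f : T -> T,
    [/\ forall x, right_part i x -> above i (f x),
      forall y, above i y -> exists2 x, right_part i x & f x = y &
      forall s t, right_part i s -> right_part i t ->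
        lex br (f s) (f t) = lex br s t].
  move=> iM; have Ii : index_set i by right.
  have bi : big i by case: iM => [[]].
  have [cr pc] := cP i Ii.
  have [r [rr rc pr]] := pup (c i) cr.
  have [g [gY gsurj _ glex]] := above_copy bi.
  have part_root t : right_part i t -> right_part i (root t).
    by move=> [pt rt]; split; rewrite ?proot // rootE.
  have part_up s t : right_part i s -> s <= t -> right_part i t.
    move=> [ps rs] st; have E : root t = root s.
      by apply: root_eq => //; exact: le_trans st.
    by split; rewrite ?E // -proot E proot.
  have minP t : min_elements (right_part i) t <-> is_root t /\ right_part i t.
    split=> [[pt tP]|[tr pt]].
      split=> //; rewrite -(tP (root t)) //; exact: part_root.
    by split=> // y _; exact: root_min.
  have part_r : right_part i r by split; rewrite ?pr // rootE.
  (* A root strictly after the cut and not after a node of the right part stays in the fibre, since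
     [p] is monotone and takes the value [i] at both ends. *)
  have mid s u : is_root u -> right_part i s -> ~~ lex br u (c i) ->
      lex br u s -> right_part i u.
    move=> ur [ps _] uc us; split; last by rewrite rootE.
    apply: (lex_anti dblT); first by rewrite -ps plex.
    by rewrite -[X in lex _ X]pc plex // (total_nle totT).
  have [h [hY hsurj _ hlex]] : exists h : T -> T,
    [/\ forall t, right_part i (h t),
      forall x, right_part i x -> exists t, h t = x, {mono h : s t / s <= t} &
      {mono h : s t / lex br s t}].
    apply: baumgartner_copy.
    - move=> cnt; apply: (@upcone_uncountable i r bi); apply: sub_countable cnt.
      by apply: subset_card_le => t; exact: part_up part_r.
    - move=> t [s [ps st]]; exists t; split=> //; exact: part_up ps st.
    apply: (rational_basis_intro dblT) => //; first by exists r.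
    - move=> s t /minP[sr ps] /minP[tr pt] ts.
      have [e [pe se et]] := brother_between dblT ratT (etrans sr (esym tr)) ts.
      exists e; split=> //; apply/minP.
      have er : is_root e by exact: etrans pe sr.
      split=> //; apply: (mid t) => //; last exact: total_nle et.
      have [_] := ps; rewrite rootE // => /(total_nle totT) cs.
      exact: le_lt_not se.
    (* The cut itself is excluded from the right part, so a root between it and [t] shows that there
       is no first root. *)
    - move=> t /minP[tr [pt tc]]; rewrite rootE // in tc.
      have [e [pe ce et]] := brother_between dblT ratT (etrans cr (esym tr)) tc.
      exists e => //; apply/minP; have er : is_root e by exact: etrans pe cr.
      split=> //; apply: (mid t) => //; first by split=> //; rewrite rootE.
      exact: total_nle et.
    - move=> t /minP[tr [pt tc]]; have [u [ur ut pu]] := pup t tr.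
      exists u => //; apply/minP; split=> //; split; first by rewrite pu.
      rewrite rootE // in tc; rewrite rootE //.
      exact: le_lt_not (total_nle totT tc) ut.
  exact: baumgartner_copy_iso hsurj hY hlex gsurj gY glex.
have /choice[f fP] : forall i, exists f : T -> T,
    min_elements (S `&` big) i ->
    [/\ forall x, right_part i x -> above i (f x),
      forall y, above i y -> exists2 x, right_part i x & f x = y &
      forall s t, right_part i s -> right_part i t ->
        lex br (f s) (f t) = lex br s t].
  move=> i; have [/right_copy[f fP]|n] := pselect (min_elements (S `&` big) i).
    by exists f.
  by exists id.
(* Only nodes beyond the cut of a block fibre are moved into [above]; all others are sent to their
   index. *)
pose moved t := min_elements (S `&` big) (p t) /\ right_part (p t) t.
have /choice[q qP] : forall t, exists u,
    (moved t -> u = f (p t) t) /\ (~ moved t -> u = p t).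
  move=> t; have [mt|nmt] := pselect (moved t); first by exists (f (p t) t).
  by exists (p t).
(* The value stays in the cone of the index, so [lex_block] can later compare values through
   incomparable indices. *)
have q_ge t : p t <= q t.
  have [mt|nmt] := pselect (moved t); last by rewrite (qP t).2.
  rewrite (qP t).1 //; have [mM mr] := mt; have [+ _ _] := fP _ mM.
  by move=> /(_ t mr)[_ _ /ltW].
exists q; split=> [t|s Ss|s t st].
- have [mt|nmt] := pselect (moved t).
    rewrite (qP t).1 //; have [mM mr] := mt; have [+ _ _] := fP _ mM.
    by move=> /(_ t mr)[].
  by rewrite (qP t).2 //; case: (pI t) => [[]|[[]]].
- have fixed i : index_set i -> q (c i) = i.
    move=> Ii; have [cr pc] := cP i Ii; rewrite (qP (c i)).2 //.
    by move=> [_ [_]]; rewrite pc rootE // le_lex.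
  have [bs|nbs] := pselect (big s); last by exists (c s); apply: fixed; left.
  have [m ms mM] := tree_minimal treeT (P := S `&` big) (conj Ss bs).
  move: ms; rewrite le_eqVlt => /orP[/eqP<-|lt].
    by exists (c m); apply: fixed; right.
  have [_ fsurj _] := fP m mM; have [|x px <-] := fsurj s; first by split.
  by exists x; have [pxm _] := px; rewrite (qP x).1 ?pxm //; split; rewrite pxm.
(* Within one fibre, unmoved nodes take the least value of the block and moved ones are compared by
   the isomorphism [f]. *)
have [pst|pne] := pselect (p s = p t).
  have [mt|nmt] := pselect (moved t).
    have [ms|nms] := pselect (moved s).
      rewrite !(qP _).1 // -pst; case: ms => ms1 ms2; case: mt => mt1 mt2.
      by have [_ _ ->] := fP _ ms1; rewrite // pst.
    by rewrite (qP s).2 // pst le_lex.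
  (* A moved [s] would force [t] to be moved too: the root of [t] is not before that of [s], hence
     also beyond the cut. *)
  rewrite (qP t).2 // -pst.
  have [[ms1 [_ ms2]]|nms] := pselect (moved s); last first.
    by rewrite (qP s).2 // le_lex.
  case: nmt; split; first by rewrite -pst.
  split=> //; rewrite -pst; apply: contra ms2.
  exact/(lex_trans dblT)/root_lex.
(* If the index of [s] is below that of [t] in the tree, it starts no block by [index_min], so [s]
   is unmoved. The reverse tree order contradicts monotonicity of [p]. *)
case: (boolP (p s >=< p t)) => [/orP[le|le]|inc].
- rewrite (qP s).2; first by apply/le_lex/(le_trans le).
  by move=> [sM _]; apply: pne; exact: index_min.
- by case: pne; apply: (lex_anti dblT); [exact: plex | exact: le_lex].
by rewrite (lex_block dblT inc) // plex.
Qed.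

End Suborder.

End Baumgartner.

Theorem theorem5p18 (d : Order.disp_t) (T : porderType d) (br : rel T)
    (hT : baumgartner_tree br) :
  strongly_surjective (lex br).
Proof.
have dblT : doubly_ordered br by case: hT.
have totT := lex_total_order dblT.
split; first by split=> //; have [r _] := tree_inhabited hT; exact: (inhabits r).
move=> L leL [[l0] totL] [e [einj ehomo]].
(* Totality of [L] makes the embedding reflect the order, so the epimorphism onto [range e] can be
   pulled back to [L]. *)
have emono x y : lex br (e x) (e y) -> leL x y.
  move=> exy; apply: contrapT => /negP/[dup] nxy /(total_nle totL) yx.
  have exy' := total_eq totT exy (ehomo _ _ yx).
  by rewrite (einj _ _ exy') total_refl in nxy.
have [|p [pe psurj plex]] := suborder_epimorphism hT (S := range e).
  by exists (e l0); exists l0.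
have /choice[q qP] : forall t, exists l, e l = p t.
  by move=> t; have [l _ el] := pe t; exists l.
exists q; split=> [l|s t st].
  have [|t pt] := psurj (e l); first by exists l.
  by exists t; apply: einj; rewrite qP.
by apply: emono; rewrite !qP; exact: plex.
Qed.
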